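(* Let $Y$ be any normed space. (i) If $\dim Y=1$, or $Y$ is a normed plane that is isometrically isomorphic to $\ell_2^2$, then every graph is $(\ell_2^2,Y)$-flattenable. (ii) If $\dim Y\geq 3$, or $Y$ is a normed plane that is not isometrically isomorphic to $\ell_2^2$, then a graph is $(\ell_2^2,Y)$-flattenable if and only if it contains no $K_4$ minor.
   Context: All normed spaces are real and have dimension greater than zero; a normed plane is a 2-dimensional normed space; $\dim Y\ge 3$ includes infinite-dimensional $Y$. $\ell_2^2$ is $\mathbb{R}^2$ with the Euclidean norm. Isometrically isomorphic means there is a linear isometric bijection. A graph $G=(V,E)$ is finite and simple with at least one edge. The measurement map of $(G,X)$ is $f_{G,X}:X^V\to\mathbb{R}^E$, $(x_v)_{v\in V}\mapsto(\|x_v-x_w\|_X)_{vw\in E}$. The graph $G$ is $(X,Y)$-flattenable if $f_{G,X}(X^V)\supseteq f_{G,Y}(Y^V)$. $K_4$ is the complete graph on 4 vertices. A minor of a graph is any graph obtained from it by a sequence of edge deletions, edge contractions and deletions of isolated vertices. *)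

(* Defs.v *)
From HB Require Import structures.
From mathcomp Require Import all_boot all_order all_algebra.
From mathcomp Require Import all_classical all_reals all_analysis.
From mathcomp Require Import ring lra.

Set Implicit Arguments.
Unset Strict Implicit.
Unset Printing Implicit Defensive.

Import Order.TTheory GRing.Theory Num.Theory.
Import numFieldNormedType.Exports.

Local Open Scope ring_scope.

Section Dimension.
Variables (R : realType) (Y : lmodType R).

Definition lin_indep n (v : 'I_n -> Y) : Prop :=
  forall c : 'I_n -> R, \sum_(i < n) c i *: v i = 0 -> forall i, c i = 0.

Definition spanning n (v : 'I_n -> Y) : Prop :=
  forall y : Y, exists c : 'I_n -> R, y = \sum_(i < n) c i *: v i.

Definition dim_eq (n : nat) : Prop :=
  exists v : 'I_n -> Y, lin_indep v /\ spanning v.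

(* Also holds for every n when Y is infinite-dimensional. *)
Definition dim_ge (n : nat) : Prop :=
  exists v : 'I_n -> Y, lin_indep v.

End Dimension.

Arguments dim_eq {R} Y n.
Arguments dim_ge {R} Y n.

Definition isometrically_isomorphic (R : realType) (X Y : normedModType R) :
    Prop :=
  exists f : {linear X -> Y}, bijective f /\ forall x, `|f x| = `|x|.

(* The type 'rV[R]_2 itself carries the sup norm in the library, hence the
   alias. *)
Definition l22 (R : realType) : Type := 'rV[R]_2.

Section EuclideanPlane.
Variable R : realType.

HB.instance Definition _ := GRing.Lmodule.copy (l22 R) 'rV[R]_2.

Definition l22_norm (x : l22 R) : R :=
  Num.sqrt (\sum_(i < 2) (x : 'rV[R]_2) ord0 i ^+ 2).

Lemma ler_l22_normD (x y : l22 R) :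
  l22_norm (x + y) <= l22_norm x + l22_norm y.
Proof.
rewrite /l22_norm !big_ord_recl !big_ord0 !addr0 !mxE.
set a := (x : 'rV_2) _ _; set b := (x : 'rV_2) _ _.
set c := (y : 'rV_2) _ _; set d := (y : 'rV_2) _ _.
have p0 : 0 <= a ^+ 2 + b ^+ 2 by rewrite addr_ge0 ?sqr_ge0.
have q0 : 0 <= c ^+ 2 + d ^+ 2 by rewrite addr_ge0 ?sqr_ge0.
rewrite -[leRHS]ger0_norm ?addr_ge0 ?sqrtr_ge0// -[leRHS]sqrtr_sqr.
apply: ler_wsqrtr; rewrite [leRHS]sqrrD !sqr_sqrtr// -sqrtrM//.
suff : a * c + b * d <= Num.sqrt ((a ^+ 2 + b ^+ 2) * (c ^+ 2 + d ^+ 2)).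
  by move=> h; rewrite mulr2n; lra.
apply: (le_trans (ler_norm _)); rewrite -sqrtr_sqr; apply: ler_wsqrtr.
by rewrite -subr_ge0 (_ : _ - _ = (a * d - b * c) ^+ 2) ?sqr_ge0//; ring.
Qed.

Lemma l22_normZ (l : R) (x : l22 R) : l22_norm (l *: x) = `|l| * l22_norm x.
Proof.
rewrite /l22_norm -sqrtr_sqr -sqrtrM ?sqr_ge0// mulr_sumr.
by congr Num.sqrt; apply: eq_bigr => i _; rewrite mxE exprMn.
Qed.

Lemma l22_norm0_eq0 (x : l22 R) : l22_norm x = 0 -> x = 0.
Proof.
move=> /eqP; rewrite sqrtr_eq0 => h; apply/rowP => i; rewrite mxE.
have s0 : \sum_(i < 2) (x : 'rV[R]_2) ord0 i ^+ 2 == 0.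
  by rewrite eq_le h sumr_ge0// => j _; rewrite sqr_ge0.
move: s0; rewrite psumr_eq0 => [|j _]; last exact: sqr_ge0.
by move=> /allP/(_ i (mem_index_enum _)); rewrite /= sqrf_eq0 => /eqP.
Qed.

HB.instance Definition _ :=
  Lmodule_isNormed.Build R (l22 R) ler_l22_normD l22_normZ l22_norm0_eq0.

End EuclideanPlane.

Record sgraph := SGraph {
  vertex : finType;
  adj : rel vertex;
  adj_sym : symmetric adj;
  adj_irr : irreflexive adj }.

Definition has_edge (G : sgraph) : Prop := exists v w : vertex G, adj v w.

(* The edge set E: an edge vw is represented once, by the ordered pair of its
   ends that is increasing for the enumeration of the vertices. *)
Definition edge (G : sgraph) : Type :=
  {e : vertex G * vertex G |
    adj e.1 e.2 && (enum_rank e.1 < enum_rank e.2)%N}.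

Definition measurement (R : realType) (G : sgraph) (X : normedModType R)
    (x : vertex G -> X) : edge G -> R :=
  fun e => `|x (val e).1 - x (val e).2|.

Definition flattenable (R : realType) (X Y : normedModType R) (G : sgraph) :
    Prop :=
  (range (@measurement R G Y) `<=` range (@measurement R G X))%classic.

Section EdgeDeletion.
Variables (G : sgraph) (x y : vertex G).

Definition del_edge_adj : rel (vertex G) :=
  fun u v => adj u v &&
    ~~ [|| (u == x) && (v == y) | (u == y) && (v == x)].

Lemma del_edge_sym : symmetric del_edge_adj.
Proof.
move=> u v; rewrite /del_edge_adj adj_sym orbC.
by rewrite [(v == y) && _]andbC [(v == x) && _]andbC.
Qed.

Lemma del_edge_irr : irreflexive del_edge_adj.
Proof. by move=> u; rewrite /del_edge_adj adj_irr. Qed.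

Definition del_edge : sgraph := SGraph del_edge_sym del_edge_irr.

End EdgeDeletion.

Section VertexDeletion.
Variables (G : sgraph) (x : vertex G).

Definition del_vertex_adj : rel {v : vertex G | v != x} :=
  fun u v => adj (val u) (val v).

Lemma del_vertex_sym : symmetric del_vertex_adj.
Proof. by move=> u v; rewrite /del_vertex_adj adj_sym. Qed.

Lemma del_vertex_irr : irreflexive del_vertex_adj.
Proof. by move=> u; rewrite /del_vertex_adj adj_irr. Qed.

Definition del_vertex : sgraph := SGraph del_vertex_sym del_vertex_irr.

End VertexDeletion.

(* Contraction of the edge xy: the vertex y is merged into x; the loop and the
   parallel edges that this creates are discarded, so the graph stays simple. *)
Section EdgeContraction.
Variables (G : sgraph) (x y : vertex G).

Definition contract_adj : rel {v : vertex G | v != y} :=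
  fun u v => (u != v) &&
    [|| adj (val u) (val v),
        (val u == x) && adj y (val v) |
        (val v == x) && adj (val u) y].

Lemma contract_sym : symmetric contract_adj.
Proof.
move=> u v; rewrite /contract_adj eq_sym (adj_sym (val u) (val v)).
rewrite (adj_sym y (val v)) (adj_sym (val u) y).
by congr (_ && (_ || _)); rewrite orbC.
Qed.

Lemma contract_irr : irreflexive contract_adj.
Proof. by move=> u; rewrite /contract_adj eqxx. Qed.

Definition contract : sgraph := SGraph contract_sym contract_irr.

End EdgeContraction.

Inductive minor_step (G : sgraph) : sgraph -> Prop :=
| step_del_edge (x y : vertex G) : adj x y -> minor_step G (del_edge x y)
| step_contract (x y : vertex G) : adj x y -> minor_step G (contract x y)
| step_del_vertex (x : vertex G) :
    (forall v, ~~ adj x v) -> minor_step G (del_vertex x).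

Inductive minor (G : sgraph) : sgraph -> Prop :=
| minor_refl : minor G G
| minor_trans (H K : sgraph) : minor G H -> minor_step H K -> minor G K.

Definition graph_iso (G H : sgraph) : Prop :=
  exists f : vertex G -> vertex H,
    bijective f /\ forall u v, adj (f u) (f v) = adj u v.

Definition has_minor (G H : sgraph) : Prop :=
  exists M : sgraph, minor G M /\ graph_iso M H.

Section Complete.
Variable n : nat.

Definition complete_adj : rel 'I_n := fun u v => u != v.

Lemma complete_sym : symmetric complete_adj.
Proof. by move=> u v; rewrite /complete_adj eq_sym. Qed.

Lemma complete_irr : irreflexive complete_adj.
Proof. by move=> u; rewrite /complete_adj eqxx. Qed.

Definition complete : sgraph := SGraph complete_sym complete_irr.

End Complete.

(* Main.v *)
Require Import Defs.
From HB Require Import structures.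
From mathcomp Require Import all_boot all_order all_algebra.
From mathcomp Require Import all_classical all_reals all_analysis.
From mathcomp Require Import ring lra zify.

(** Flattening into the Euclidean plane is governed by two facts.

    A graph without a [K_4] minor has a vertex [x] with at most two neighbours
    ([no_K4_minor_low_degree]).  Contracting [x] into one of them makes the two
    adjacent, so by induction the rest of the graph is drawn in the plane with
    the two neighbours at their prescribed distance, and the triangle
    inequality is exactly what is needed to put [x] back
    ([triangle_vertex]).  Hence the edge lengths of any metric on the vertices
    are realized in the plane ([no_K4_minor_realizable]), whatever [Y] is.

    Conversely, flattenability passes to minors ([flattenable_has_minor]): a
    contracted edge is an edge of length zero.  So a flattenable graph with a
    [K_4] minor makes [K_4] itself flattenable, that is, any four points of [Y]
    embed isometrically in the plane ([four_point]).  Embedding [0], [x], [y]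
    and [t x] shows, the image of [t x] being forced, that the squared norm of
    [Y] is a quadratic form on each subspace spanned by two vectors
    ([normD_sqr]).  If [Y] has dimension 2, it is therefore Euclidean
    ([four_point_dim2]).  If it contains independent [x, y, z], embed these
    and [0]; in the plane the image of [z] is a combination [a p + b q] of
    those of [x] and [y], and following the midpoint of [2a x] and [2b y]
    shows that [z = a x + b y], a contradiction ([four_point_dim3]).

    The vertex of degree at most two comes from a longest path.  If every
    vertex has three neighbours, the neighbours of the first vertex lie on the
    path; let [j] bound their positions.  Rotating the path at a neighbour of
    position [i] with [1 < i < j] gives another longest path, whose first
    vertex either is adjacent to a vertex beyond position [i], and then the two
    chords cut the path into four pairwise adjacent segments
    ([crossing_chords_minor]), or has all its neighbours within position [i]
    ([longest_minor]).  The latter cannot go on for ever. *)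

Set Implicit Arguments.
Unset Strict Implicit.
Unset Printing Implicit Defensive.
Import Order.TTheory GRing.Theory Num.Theory.
Import numFieldNormedType.Exports.

(** * Clique minors from branch sets *)

Lemma minor_step_trans G H K : minor_step G H -> minor H K -> minor G K.
Proof.
move=> sGH; elim=> [|H' K' _ IH s]; last exact: minor_trans IH s.
exact: minor_trans (minor_refl G) sGH.
Qed.

Lemma has_minor_step G H K : minor_step G H -> has_minor H K -> has_minor G K.
Proof.
by move=> s [M [mM iM]]; exists M; split=> //; apply: minor_step_trans s mM.
Qed.

(** The branch set of [c] is [f @^-1 (Some c)]; vertices sent to [None] are to be
    deleted.  Connectedness of a branch set is expressed by cuts: any [A] that
    separates two of its vertices is crossed by one of its edges.  Unlike
    paths, cuts of a contracted graph pull back by mere composition with the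
    quotient map. *)
Definition clique_model n (G : sgraph) (f : vertex G -> option 'I_n) : Prop :=
  (forall c (A : pred (vertex G)) x y,
      f x = Some c -> f y = Some c -> A x -> ~~ A y ->
      exists u v, [/\ f u = Some c, f v = Some c, adj u v & A u != A v]) /\
  (forall c d, c != d ->
      exists u v, [/\ f u = Some c, f v = Some d & adj u v]).

(** The quotient map on vertices of the contraction of [xy], defined for all
    distinct [x] and [y]. *)
Definition merge_end (G : sgraph) (x y : vertex G) (xy : x != y) (v : vertex G) :
    {v : vertex G | v != y} := insubd (exist _ x xy : {v | v != y}) v.

Lemma val_merge G x y xy v :
  val (@merge_end G x y xy v) = if v == y then x else v.
Proof. by rewrite /merge_end val_insubd; case: eqP. Qed.

Lemma merge_val G x y xy v : @merge_end G x y xy (val v) = v.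
Proof. by apply: val_inj; rewrite val_merge (negPf (valP v)). Qed.

Lemma adj_neq (G : sgraph) (x y : vertex G) : adj x y -> x != y.
Proof. by apply: contraTneq => ->; rewrite adj_irr. Qed.

Lemma adj_merge G x y xy u v :
  @merge_end G x y xy u != merge_end xy v -> adj u v ->
  @adj (Defs.contract x y) (merge_end xy u) (merge_end xy v).
Proof.
move=> ne uv; rewrite /= /contract_adj ne !val_merge /=.
move: ne; rewrite -(inj_eq val_inj) !val_merge.
case: (u =P y) uv => [->|/eqP uy]; case: (v =P y) => [->|/eqP vy] uv.
- by rewrite eqxx.
- by rewrite uv eqxx /= orbT.
- by rewrite uv eqxx /= !orbT.
- by rewrite uv.
Qed.

Lemma clique_model_contract n (G : sgraph) (f : vertex G -> option 'I_n)
    (x y : vertex G) : adj x y -> f x = f y -> clique_model f ->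
  clique_model (fun v : vertex (Defs.contract x y) => f (val v)).
Proof.
move=> /adj_neq xy fxy [con pw].
have fm v : f (val (merge_end xy v)) = f v.
  by rewrite val_merge; case: eqP => [->|].
split=> [c A a b fa fb Aa Ab|c d cd].
- have [||u [v [fu fv uv Auv]]] := con c (A \o merge_end xy) (val a) (val b) fa fb.
  + by rewrite /= merge_val.
  + by rewrite /= merge_val.
  exists (merge_end xy u), (merge_end xy v); rewrite !fm; split=> //.
  by apply: adj_merge => //; apply: contraNneq Auv => /= ->.
- have [u [v [fu fv uv]]] := pw c d cd.
  exists (merge_end xy u), (merge_end xy v); rewrite !fm; split=> //.
  apply: adj_merge => //; apply: contraNneq cd => e.
  by move: fu; rewrite -fm e fm fv => -[->].
Qed.

Lemma clique_model_del_edge n (G : sgraph) (f : vertex G -> option 'I_n)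
    (x y : vertex G) : f x = None -> clique_model f ->
  clique_model (G := del_edge x y) f.
Proof.
move=> fx [con pw].
have keep u v : isSome (f u) -> isSome (f v) -> adj u v ->
    @adj (del_edge x y) u v.
  move=> fu fv uv; rewrite /= /del_edge_adj uv /=.
  have /negPf-> : u != x by apply: contraTneq fu => ->; rewrite fx.
  have /negPf-> : v != x by apply: contraTneq fv => ->; rewrite fx.
  by rewrite /= andbF.
split=> [c A a b fa fb Aa Ab|c d cd].
- have [u [v [fu fv uv Auv]]] := con c A a b fa fb Aa Ab.
  by exists u, v; split=> //; apply: keep; rewrite ?fu ?fv.
- have [u [v [fu fv uv]]] := pw c d cd.
  by exists u, v; split=> //; apply: keep; rewrite ?fu ?fv.
Qed.

Lemma clique_model_del_vertex n (G : sgraph) (f : vertex G -> option 'I_n)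
    (x : vertex G) : f x = None -> clique_model f ->
  clique_model (fun v : vertex (del_vertex x) => f (val v)).
Proof.
move=> fx [con pw].
have keep u c : f u = Some c -> u != x.
  by move=> fu; apply/eqP => e; rewrite e fx in fu.
split=> [c A a b fa fb Aa Ab|c d cd].
- have [||u [v [fu fv uv Auv]]] :=
    con c (fun v => A (insubd a v)) (val a) (val b) fa fb.
  + by rewrite valKd.
  + by rewrite valKd.
  exists (insubd a u), (insubd a v); split=> //.
  + by rewrite insubdK // unfold_in (keep _ _ fu).
  + by rewrite insubdK // unfold_in (keep _ _ fv).
  + by rewrite /= /del_vertex_adj !insubdK // unfold_in (keep _ c).
- have [u [v [fu fv uv]]] := pw c d cd.
  by exists (exist _ u (keep _ _ fu)), (exist _ v (keep _ _ fv)).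
Qed.

Lemma card_predC1_lt (T : finType) (x : T) : (#|[pred v | v != x]| < #|T|)%N.
Proof. by rewrite -(cardC (pred1 x)) card1. Qed.

(** Vertices outside the branch sets are isolated edge by edge and deleted, and
    edges inside a branch set are contracted.  When neither step applies, a
    connected branch set without edges is a single vertex. *)
Lemma clique_model_minor n (G : sgraph) (f : vertex G -> option 'I_n) :
  (1 < n)%N -> clique_model f -> has_minor G (complete n).
Proof.
move=> n1; have [N] := ubnP #|vertex G|; elim: N G f => // N IHN G f VN mf.
have [/existsP[x /eqP fx]|/existsPn fN] := boolP [exists x, f x == None].
  have [D dx] := ubnP #|@adj G x|.
  elim: D G f VN mf x fx dx => // D IHD G f VN mf x fx dx.
  have [/existsP[y xy]|/existsPn xN] := boolP [exists y, adj x y].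
    apply: has_minor_step (step_del_edge xy) _.
    apply: (IHD (del_edge x y) f _ (clique_model_del_edge y fx mf) x fx) => //.
    rewrite -ltnS (leq_trans _ dx) // ltnS; apply: proper_card.
    apply/properP; split.
      by apply/fintype.subsetP => z; rewrite !unfold_in => /andP[].
    by exists y => //; rewrite unfold_in /= /del_edge_adj !eqxx andbF.
  apply: has_minor_step (step_del_vertex xN) _.
  apply: (IHN (del_vertex x) _ _ (clique_model_del_vertex fx mf)).
  rewrite -ltnS (leq_trans _ VN) // ltnS card_sig.
  exact: card_predC1_lt.
have [/existsP[x /existsP[y /andP[xy /eqP fxy]]]|/existsPn mono] :=
  boolP [exists x, exists y, adj x y && (f x == f y)].
  apply: has_minor_step (step_contract xy) _.
  apply: (IHN (Defs.contract x y) _ _ (clique_model_contract xy fxy mf)).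
  rewrite -ltnS (leq_trans _ VN) // ltnS card_sig.
  exact: card_predC1_lt.
exists G; split; first exact: minor_refl.
have [con pw] := mf.
have mono' u v : adj u v -> f u != f v.
  by move=> uv; apply: contraNneq (mono u) => e; apply/existsP; exists v; rewrite uv e eqxx.
(* The cut around a vertex x of a branch set would be crossed by an edge of
   that branch set, and there is none left. *)
have finj : injective f.
  move=> x y fxy; apply/eqP/negPn/negP => xy.
  case fx : (f x) (fN x) => [c|//] _.
  have [||u [v [fu fv uv _]]] := con c (pred1 x) x y fx _ (eqxx _).
  - by rewrite -fxy.
  - by rewrite /= eq_sym.
  by move: (mono' _ _ uv); rewrite fu fv eqxx.
pose c0 : 'I_n := Ordinal n1.
pose g v := odflt c0 (f v).
have gE v : f v = Some (g v) by rewrite /g; case: (f v) (fN v).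
have ginj : injective g by move=> u v e; apply: finj; rewrite !gE e.
(* As n > 1, there is a color other than c, and the edge between the two branch
   sets shows that the one of c is not empty. *)
have gsurj c : exists v, g v = c.
  have [d cd] : exists d : 'I_n, c != d.
    have [->|cn] := eqVneq c c0.
      by exists (Ordinal (ltn_trans (ltn0Sn 0) n1)).
    by exists c0.
  by have [u [_ [fu _ _]]] := pw c d cd; exists u; rewrite /g fu.
exists g; split.
  have [h hK] := choice gsurj.
  by exists h => // v; apply: ginj; rewrite hK.
move=> u v; rewrite /= /complete_adj; apply/idP/idP.
  move=> /pw[u' [v' []]]; rewrite !gE => -[/ginj->] [/ginj->] //.
by move=> /mono'; rewrite !gE; apply: contraNneq => ->.
Qed.

(** * A vertex with at most two neighbours *)

Lemma nat_interval_cut (B : pred nat) l h a b :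
  (l <= a < h)%N -> (l <= b < h)%N -> B a -> ~~ B b ->
  exists k, [/\ (l <= k)%N, (k.+1 < h)%N & B k != B k.+1].
Proof.
move=> la lb Ba Bb; apply: contrapT => /forallNP no.
have step k : (l <= k)%N -> (k.+1 < h)%N -> B k = B k.+1.
  by move=> lk kh; apply/eqP/negPn/negP => ne; apply: (no k).
have Bl k : (l + k < h)%N -> B (l + k)%N = B l.
  elim: k => [|k IH]; first by rewrite addn0.
  by rewrite addnS => kh; rewrite -step ?IH ?leq_addr // ltnW.
move: Ba (Bb); rewrite -(subnKC (n := a) (m := l)); last by case/andP: la.
rewrite -(subnKC (n := b) (m := l)); last by case/andP: lb.
by rewrite !Bl; [move=> ->| |]; lia.
Qed.

Section LongestPath.
Variable G : sgraph.
Implicit Types (s : seq (vertex G)) (x : vertex G).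

(** The path is cut before the positions [i - 1], [i] and [minn j m], and ends at
    [maxn j m].  Consecutive segments are joined by the path, the first and the
    third by the chord [0 i], the first and the last by [0 j], the second and
    the last by the chord [(i - 1) m]; this covers [m < j] and [j <= m] at
    once. *)
Lemma crossing_chords_minor x0 s i j m :
  sorted (@adj G) s -> uniq s ->
  (1 < i < j)%N -> (i < m)%N -> (j < size s)%N -> (m < size s)%N ->
  adj (nth x0 s 0) (nth x0 s i) -> adj (nth x0 s 0) (nth x0 s j) ->
  adj (nth x0 s i.-1) (nth x0 s m) -> has_minor G (complete 4).
Proof.
move=> /(sortedP x0) so us /andP[i1 ij] im js ms a0i a0j aim.
(* Segment c occupies the positions k with lo c <= k < hi c. *)
pose lo (c : nat) := nth 0%N [:: 0; i.-1; i; minn j m]%N c.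
pose hi (c : nat) := nth 0%N [:: i.-1; i; minn j m; (maxn j m).+1]%N c.
pose col k : option 'I_4 := [pick c : 'I_4 | (lo c <= k < hi c)%N].
have colP k c : (col k = Some c) <-> (lo c <= k < hi c)%N.
  rewrite /col; case: pickP => [d dk|no]; last by split=> //; rewrite no.
  split=> [[<-] //|ck]; congr Some; apply: val_inj.
  move: ck dk; rewrite /lo /hi.
  by case: c => [[|[|[|[|c]]]] //= ?]; case: d => [[|[|[|[|d]]]] //= ?]; lia.
have hiS (c : 'I_4) k : (k < hi c)%N -> (k < size s)%N.
  by rewrite /hi; case: c => [[|[|[|[|c]]]] //= ?]; lia.
apply: (@clique_model_minor 4 G (fun v => col (index v s))) => //.
have vert k (c : 'I_4) : (lo c <= k < hi c)%N -> col (index (nth x0 s k) s) = Some c.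
  by move=> kc; apply/colP; rewrite index_uniq //; apply: (hiS c); case/andP: kc.
split=> [c A x y /colP xc /colP yc Ax Ay|c d cd].
  have nx z : (lo c <= index z s < hi c)%N -> nth x0 s (index z s) = z.
    by move=> /andP[_ /hiS]; rewrite index_mem => /(nth_index x0).
  have [||k [lk kh Bk]] := nat_interval_cut (B := A \o nth x0 s) xc yc.
  - by rewrite /= nx.
  - by rewrite /= nx.
  exists (nth x0 s k), (nth x0 s k.+1); split=> //; last exact/so/(hiS c).
    by apply: vert; lia.
  by apply: vert; lia.
wlog cd' : c d cd / (c < d)%N.
  move=> wl; have [|dc|e] := ltngtP c d; first exact: wl.
    by have [|u [v [fu fv uv]]] := wl d c _ dc; [rewrite eq_sym|exists v, u; rewrite adj_sym].
  by move: cd; rewrite (val_inj e) eqxx.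
suff [k [l [kc ld kl]]] : exists k l, [/\ (lo c <= k < hi c)%N,
    (lo d <= l < hi d)%N & adj (nth x0 s k) (nth x0 s l)].
  by exists (nth x0 s k), (nth x0 s l); split=> //; apply: vert.
have cons k : (k.+1 < size s)%N -> adj (nth x0 s k) (nth x0 s k.+1) := so k.
have nx k l : (l < size s)%N -> l = k.+1 -> adj (nth x0 s k) (nth x0 s l).
  by move=> ls e; rewrite e; apply: cons; rewrite -e.
case: c d {cd} cd' => [[|[|[|[|c]]]] //= ?] [[|[|[|[|d]]]] //= ?] _; rewrite /lo /hi /=.
- by exists i.-2, i.-1; split; [lia|lia|apply: nx; lia].
- by exists 0%N, i; split; [lia|lia|].
- by exists 0%N, j; split; [lia|lia|].
- by exists i.-1, i; split; [lia|lia|apply: nx; lia].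
- by exists i.-1, m; split; [lia|lia|].
- by exists (minn j m).-1, (minn j m); split; [lia|lia|apply: nx; lia].
Qed.

Definition longest_path s :=
  [/\ sorted (@adj G) s, uniq s &
    forall t, sorted (@adj G) t -> uniq t -> (size t <= size s)%N].

Lemma longest_head_adj x0 s z :
  longest_path s -> s != [::] -> adj (nth x0 s 0) z -> z \in s.
Proof.
case: s => // x s [ss us mx] _ /= xz; apply: contraT => zs.
have := mx (z :: x :: s); rewrite /= ltnn => -> //.
  by rewrite adj_sym xz.
by move: us zs => /= -> ->.
Qed.

(** Minimum degree three, in the form in which a third neighbour is picked. *)
Hypothesis deg3 : forall x a b : vertex G,
  exists z, [/\ adj x z, z != a & z != b].

(** Induction on the bound [j] for the positions of the neighbours of the first
    vertex: a rotation yields crossing chords or a longest path with a smaller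
    bound. *)
Lemma longest_minor x0 j s : longest_path s -> s != [::] ->
  (forall z, adj (nth x0 s 0) z -> (index z s <= j)%N) ->
  has_minor G (complete 4).
Proof.
elim: j s => [|j IH] s ls s0 hj.
  have [z [xz zx _]] := deg3 (nth x0 s 0) (nth x0 s 0) x0.
  move: (hj z xz) (longest_head_adj ls s0 xz) zx; rewrite leqn0 => /eqP <- zs.
  by rewrite nth_index // eqxx.
have nbr z : adj (nth x0 s 0) z -> z \in s := longest_head_adj ls s0.
have [/andP[js xj]|] := boolP ((j.+1 < size s)%N && adj (nth x0 s 0) (nth x0 s j.+1)); last first.
  move=> nxj; apply: (IH s) => // z xz.
  move: (hj z xz); rewrite leq_eqVlt => /orP[/eqP e|//].
  by move: nxj; rewrite -e index_mem nbr //= nth_index ?nbr // xz.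
have [ss us mx] := ls; have /(sortedP x0) so := ss.
(* A third neighbour, at a position i with 1 < i < j.+1, at which to rotate. *)
have [z [xz z1 zj]] := deg3 (nth x0 s 0) (nth x0 s 1) (nth x0 s j.+1).
have zs := nbr z xz.
pose i := index z s; have zE : nth x0 s i = z by rewrite nth_index.
have i0 : i != 0%N by apply: contraTneq xz => i0; rewrite -zE i0 adj_irr.
have i1 : i != 1%N by apply: contraNneq z1 => i1; rewrite -zE i1.
have ij : i != j.+1 by apply: contraNneq zj => ij; rewrite -zE ij.
have ilj : (i <= j.+1)%N := hj z xz.
have i2 : (1 < i)%N by clear -i0 i1; case: i i0 i1 => [|[]].
have {ij ilj} ij : (i <= j)%N by rewrite -ltnS ltn_neqAle ij.
have isz : (i < size s)%N by rewrite index_mem.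
(* The rotated path starts at position i.-1 of s. *)
pose t := rev (take i s) ++ drop i s.
have tE k : nth x0 t k = if (k < i)%N then nth x0 s (i.-1 - k) else nth x0 s k.
  rewrite nth_cat size_rev size_take isz; case: ltnP => ki.
    rewrite nth_rev ?size_take ?isz // nth_take; last by clear -ki i2; lia.
    by congr nth; clear -ki; lia.
  by rewrite nth_drop subnKC.
have pst : perm_eq t s by rewrite /t -{3}(cat_take_drop i s) perm_cat2r perm_rev.
have st := perm_size pst.
have ut : uniq t by rewrite (perm_uniq pst).
have sot : sorted (@adj G) t.
  apply/(sortedP x0) => k; rewrite st !tE => ks.
  have [ki|ki] := ltnP k i; have [ki'|ki'] := ltnP k.+1 i; last 2 first.
  - by clear -ki ki'; lia.
  - exact: so.
  - rewrite (_ : (i.-1 - k) = (i.-1 - k.+1).+1)%N; last by clear -ki'; lia.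
    by rewrite adj_sym; apply: so; clear -ki' isz; lia.
  - have -> : k.+1 = i by clear -ki ki'; lia.
    by rewrite (_ : (i.-1 - k) = 0)%N ?zE //; clear -ki ki'; lia.
have lt : longest_path t by split=> //; rewrite st.
have t0 : t != [::] by rewrite -size_eq0 st size_eq0.
have t0E : nth x0 t 0 = nth x0 s i.-1 by rewrite tE lt0n i0 subn0.
have [/existsP[w /andP[aw iw]]|/existsPn no] :=
  boolP [exists w, adj (nth x0 s i.-1) w && (i < index w s)%N].
  have ws : w \in s.
    by rewrite -(perm_mem pst) (longest_head_adj (x0 := x0) lt) ?t0E.
  apply: (@crossing_chords_minor x0 s i j.+1 (index w s)) => //.
  - by rewrite i2 ltnS.
  - by rewrite index_mem.
  - by rewrite zE.
  - by rewrite nth_index.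
apply: (IH t) => // w; rewrite t0E => aw.
have := no w; rewrite aw -leqNgt /= => wi.
have ws : w \in s.
  by rewrite -(perm_mem pst) (longest_head_adj (x0 := x0) lt) ?t0E.
have wE := nth_index x0 ws.
suff [k [ki kw]] : exists k, (k <= i)%N /\ nth x0 t k = w.
  rewrite -kw index_uniq ?(leq_trans ki) //; by rewrite st (leq_ltn_trans ki).
move: wi; rewrite leq_eqVlt => /orP[/eqP e|wi].
  by exists i; rewrite tE ltnn -e wE.
exists (i.-1 - index w s)%N; split; first by clear; lia.
rewrite tE ifT; last by clear -i2; lia.
by rewrite -[RHS]wE; congr nth; clear -wi; lia.
Qed.

Lemma deg3_minor : vertex G -> has_minor G (complete 4).
Proof.
move=> x.
pose P n := [exists t : n.-tuple (vertex G), sorted (@adj G) t && uniq t].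
have exP : exists n, P n by exists 1%N; apply/existsP; exists [tuple x].
have leP n : P n -> (n <= #|vertex G|)%N.
  move=> /existsP[t /andP[_ /card_uniqP]]; rewrite size_tuple => <-.
  exact: max_card.
case: (ex_maxnP exP leP) => n /existsP[s /andP[ss us]] mx.
have ls : longest_path s.
  split=> // t st ut; rewrite size_tuple; apply: mx.
  by apply/existsP; exists (in_tuple t); rewrite st.
have s0 : tval s != [::].
  rewrite -size_eq0 size_tuple -lt0n; apply: mx.
  by apply/existsP; exists [tuple x].
apply: (@longest_minor x (size s) s) => // z xz.
by rewrite ltnW // index_mem (longest_head_adj ls s0 xz).
Qed.
End LongestPath.

Lemma no_K4_minor_low_degree (G : sgraph) : ~ has_minor G (complete 4) ->
  vertex G -> exists x a b : vertex G, forall z, adj x z -> z = a \/ z = b.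
Proof.
move=> noK4 v; apply: contrapT => no; apply/noK4/deg3_minor => // x a b.
apply: contrapT => /forallNP no3; apply: no; exists x, a, b => z xz.
apply: contrapT => /not_orP[/eqP za /eqP zb]; exact: (no3 z).
Qed.

(** * Flattenability and minors *)

Section Flattenable.
Local Open Scope ring_scope.
Variables (R : realType) (X Y : normedModType R).

(** Lengths are symmetric in the ends of an edge, so the choice of one ordered
    pair for each edge in the measurement map is immaterial. *)
Lemma flattenableP (G : sgraph) : flattenable X Y G <->
  forall y : vertex G -> Y, exists x : vertex G -> X,
    forall u v, adj u v -> `|x u - x v| = `|y u - y v|.
Proof.
split=> [fl y|fl _ [y _ <-]].
  have [x _ xy] := fl _ (ex_intro2 _ _ y I erefl).
  exists x => u v uv.
  have meas a b (ab : adj a b) (r : (enum_rank a < enum_rank b)%N) :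
      `|x a - x b| = `|y a - y b|.
    have eP : adj (a, b).1 (a, b).2 && (enum_rank (a, b).1 < enum_rank (a, b).2)%N.
      by rewrite /= ab.
    exact: (congr1 (fun m => m (exist _ (a, b) eP : edge G)) xy).
  have [r|r|r] := ltngtP (enum_rank u) (enum_rank v).
  - exact: meas.
  - by rewrite distrC [RHS]distrC; apply: meas => //; rewrite adj_sym.
  - by move: uv; rewrite (enum_rank_inj (val_inj r)) adj_irr.
have [x xy] := fl y; exists x => //; apply/funext => -[[u v] /= uvP].
have [uv _] := andP uvP; exact: xy uv.
Qed.

Definition extend (G : sgraph) (x : vertex G) (T : Type) (t : T)
    (p : {v : vertex G | v != x} -> T) (v : vertex G) : T :=
  oapp p t (insub v).

Lemma extend_val (G : sgraph) (x : vertex G) T (t : T) p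
    (v : {v : vertex G | v != x}) : extend t p (val v) = p v.
Proof. by rewrite /extend valK. Qed.

Lemma extend_at (G : sgraph) (x : vertex G) T (t : T) p :
  @extend G x T t p x = t.
Proof. by rewrite /extend insubN // eqxx. Qed.

(** The only step that is not a restriction is a contraction: the configuration
    in [Y] is lifted by placing the two ends of the edge at the same point;
    this edge then has length zero, so its ends also coincide in [X]. *)
Lemma flattenable_minor_step (G H : sgraph) :
  minor_step G H -> flattenable X Y G -> flattenable X Y H.
Proof.
move=> step /flattenableP fl; apply/flattenableP.
case: step => [x y xy|x y xy|x _] q.
- have [p pq] := fl q; exists p => u v /andP[uv _]; exact: pq.
- have ne := adj_neq xy.
  have [p pq] := fl (q \o merge_end ne).
  have pxy : p x = p y.
    apply/eqP; rewrite -subr_eq0 -normr_eq0 pq //=.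
    have -> : merge_end ne x = merge_end ne y; last by rewrite subrr normr0.
    by apply: val_inj; rewrite !val_merge eqxx (negPf ne).
  have pq' u v : adj (val u) v ->
      `|p (val u) - p v| = `|q u - q (merge_end ne v)|.
    by move=> uv; rewrite pq //= merge_val.
  exists (p \o val) => u v /andP[_ /or3P[uv|/andP[/eqP ux yv]|/andP[/eqP vx uy]]].
  + by rewrite /= pq' // merge_val.
  + rewrite /= distrC ux pxy pq'; last by rewrite adj_sym.
    rewrite [RHS]distrC; by congr (`|_ - q _|); apply: val_inj; rewrite val_merge eqxx.
  + rewrite /= vx pxy pq' //.
    by congr (`|_ - q _|); apply: val_inj; rewrite val_merge eqxx.
- have [p pq] := fl (extend 0 q).
  by exists (p \o val) => u v uv; rewrite /= pq // !extend_val.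
Qed.

Lemma flattenable_has_minor (G H : sgraph) :
  has_minor G H -> flattenable X Y G -> flattenable X Y H.
Proof.
move=> [M [mM [f [[g gf fg] fadj]]]] flG.
have /flattenableP fl : flattenable X Y M.
  by clear -mM flG; elim: mM flG => // M' K _ IH s /IH; apply: flattenable_minor_step.
apply/flattenableP => y; have [x xy] := fl (y \o f).
exists (x \o g) => u v uv; rewrite /= xy /= ?fg //.
by rewrite -fadj !fg.
Qed.

End Flattenable.

(** * Realizing metrics in the Euclidean plane *)

Section EuclideanPlane.
Local Open Scope ring_scope.
Variable R : realType.
Implicit Types p q : l22 R.

Definition xc p : R := (p : 'rV[R]_2) ord0 ord0.
Definition yc p : R := (p : 'rV[R]_2) ord0 ord_max.
Definition pt (a b : R) : l22 R := \row_(i < 2) (if i == ord0 then a else b).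

Lemma ptE a b : (xc (pt a b) = a) * (yc (pt a b) = b).
Proof. by rewrite /xc /yc !mxE. Qed.

Lemma coordD p q : (xc (p + q) = xc p + xc q) * (yc (p + q) = yc p + yc q).
Proof. by rewrite /xc /yc !mxE. Qed.

Lemma coordN p : (xc (- p) = - xc p) * (yc (- p) = - yc p).
Proof. by rewrite /xc /yc !mxE. Qed.

Lemma coordZ t p : (xc (t *: p) = t * xc p) * (yc (t *: p) = t * yc p).
Proof. by rewrite /xc /yc !mxE. Qed.

Definition coordE := (coordD, coordN, coordZ, ptE).

Lemma l22_normK p : `|p| ^+ 2 = xc p ^+ 2 + yc p ^+ 2.
Proof.
rewrite sqr_sqrtr ?sumr_ge0 // => [|i _]; last exact: sqr_ge0.
by rewrite !big_ord_recl big_ord0 addr0; congr (_ + _ ^+ 2); congr (_ _ _); apply: val_inj.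
Qed.

Lemma l22_norm_eq p r : 0 <= r -> xc p ^+ 2 + yc p ^+ 2 = r ^+ 2 -> `|p| = r.
Proof.
by move=> r0 e; apply/eqP; rewrite -(eqrXn2 (n := 2)) // l22_normK e.
Qed.

(** The degenerate case [p = q], where the hypotheses force [r = s], is needed
    for a vertex with a single neighbour. *)
Lemma triangle_vertex p q r s :
  `|r - s| <= `|p - q| -> `|p - q| <= r + s ->
  exists z : l22 R, `|z - p| = r /\ `|z - q| = s.
Proof.
rewrite ler_norml => /andP[lo hi] sum.
have r0 : 0 <= r by lra.
have s0 : 0 <= s by lra.
have [pq|pq] := eqVneq p q.
  move: lo hi sum; rewrite pq subrr normr0 => lo hi sum.
  have <- : r = s by lra.
  by exists (q + pt r 0); rewrite addrAC subrr add0r; split;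
    apply: l22_norm_eq => //; rewrite !coordE; ring.
have D0 : 0 < `|p - q| by rewrite normr_gt0 subr_eq0.
have := l22_normK (p - q); rewrite !coordE.
move: {pq} `|p - q| D0 lo hi sum => D D0 lo hi sum DE.
(* The foot of the altitude from z is at abscissa t from p on the line pq, and h
   is the altitude; (ex, ey) is the unit vector from p to q. *)
pose t := (r ^+ 2 - s ^+ 2 + D ^+ 2) / (2 * D).
have tD : 2 * D * t = r ^+ 2 - s ^+ 2 + D ^+ 2 by rewrite /t; field; lra.
have hr : 0 <= r ^+ 2 - t ^+ 2.
  have tr : t <= r.
    by rewrite -(ler_pM2l (x := 2 * D)) ?tD; [nra|lra].
  have rt : - r <= t.
    by rewrite -(ler_pM2l (x := 2 * D)) ?tD; [nra|lra].
  by nra.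
pose h := Num.sqrt (r ^+ 2 - t ^+ 2).
have hE : h ^+ 2 = r ^+ 2 - t ^+ 2 by rewrite sqr_sqrtr.
pose ex := (xc q - xc p) / D; pose ey := (yc q - yc p) / D.
have e1 : ex ^+ 2 + ey ^+ 2 = 1.
  have -> : ex ^+ 2 + ey ^+ 2 =
      ((xc p - xc q) ^+ 2 + (yc p - yc q) ^+ 2) / D ^+ 2.
    by rewrite /ex /ey; field; lra.
  by rewrite -DE divff // lt0r_neq0 // exprn_gt0.
have xq : xc q = xc p + D * ex by rewrite /ex; field; lra.
have yq : yc q = yc p + D * ey by rewrite /ey; field; lra.
exists (p + pt (t * ex - h * ey) (t * ey + h * ex)); split;
  apply: l22_norm_eq => //; rewrite !coordE.
  transitivity ((t ^+ 2 + h ^+ 2) * (ex ^+ 2 + ey ^+ 2)); first by ring.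
  by rewrite e1 hE; ring.
rewrite xq yq.
transitivity (((t - D) ^+ 2 + h ^+ 2) * (ex ^+ 2 + ey ^+ 2)); first by ring.
rewrite e1 hE mulr1.
transitivity (r ^+ 2 + D ^+ 2 - 2 * D * t); first by ring.
by rewrite tD; ring.
Qed.

(** A vertex [x] with at most two neighbours is contracted into one of them, so
    that the restriction of [d] to the other vertices also prescribes the
    distance between the two neighbours; [x] is then the apex of a triangle
    with given sides. *)
Lemma no_K4_minor_realizable (G : sgraph) (d : vertex G -> vertex G -> R) :
  (forall u, d u u = 0) -> (forall u v, d u v = d v u) ->
  (forall u v w, d u w <= d u v + d v w) -> ~ has_minor G (complete 4) ->
  exists p : vertex G -> l22 R, forall u v, adj u v -> `|p u - p v| = d u v.
Proof.
have [N] := ubnP #|vertex G|; elim: N G d => // N IH G d VN d0 dC dT noK4.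
have [[x0]|nov] := pselect (inhabited (vertex G)); last first.
  by exists (fun=> 0) => u; case: nov; exists.
have [x [a [b xab]]] := no_K4_minor_low_degree noK4 x0.
have VN' : (#|{: {v : vertex G | v != x}}| < N)%N.
  by rewrite -ltnS (leq_trans _ VN) // ltnS card_sig card_predC1_lt.
have cases u v : adj u v -> [\/ u = x, v = x |
    exists u' v' : {v : vertex G | v != x}, u = val u' /\ v = val v'].
  move=> uv; have [->|ux] := eqVneq u x; first by constructor 1.
  have [->|vx] := eqVneq v x; first by constructor 2.
  by constructor 3; exists (exist _ u ux), (exist _ v vx).
have [[c adj_xc]|nox] := pselect (exists c, adj x c); last first.
  have xN v : ~~ adj x v by apply/negP => xv; apply: nox; exists v.
  have [||||p pd] := IH (del_vertex x) (fun u v => d (val u) (val v)) VN' => //.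
    by move=> m; apply: noK4; apply: has_minor_step (step_del_vertex xN) m.
  exists (extend 0 p) => u v uv.
  have [ux|vx|[u' [v' [ue ve]]]] := cases u v uv.
  - by case/negP: (xN v); rewrite -ux.
  - by case/negP: (xN u); rewrite -vx adj_sym.
  - by rewrite ue ve !extend_val pd //=; rewrite /= /del_vertex_adj -ue -ve.
(* If x has a single neighbour c, it counts twice. *)
have [c' [xc' xN]] : exists c', adj x c' /\ forall z, adj x z -> z = c \/ z = c'.
  wlog ca : a b xab / c = a.
    by move=> wl; have [ca|cb] := xab c adj_xc;
      [apply: (wl a b)|apply: (wl b a)] => // z /xab[]; auto.
  have [xb|xb] := boolP (adj x b).
    by exists b; split=> // z /xab; rewrite ca.
  exists c; split=> // z xz; have [za|zb] := xab z xz; first by left; rewrite ca.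
  by rewrite zb (negPf xb) in xz.
have cx : adj c x by rewrite adj_sym.
have ne := adj_neq cx.
have ne' : c' != x by rewrite eq_sym adj_neq.
pose C := exist (fun v => v != x) c ne; pose C' := exist (fun v => v != x) c' ne'.
have [||||p pd] := IH (Defs.contract c x) (fun u v => d (val u) (val v)) VN' => //.
  by move=> m; apply: noK4; apply: has_minor_step (step_contract cx) m.
have pCC' : `|p C - p C'| = d c c'.
  have [e|cc'] := eqVneq C C'.
    by rewrite e subrr normr0; have /= <- := congr1 val e; rewrite d0.
  by rewrite pd //= /contract_adj cc' /= eqxx xc' orbT.
have [||q [qC qC']] := @triangle_vertex (p C) (p C') (d x c) (d x c').
- rewrite pCC' ler_norml; have := dT x c c'; have := dT x c' c.
  by rewrite (dC c' c); lra.
- by rewrite pCC' (dC x c).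
have qd z : adj x z -> `|q - extend q p z| = d x z.
  by case/xN => ->; [rewrite (extend_val q p C) | rewrite (extend_val q p C')].
exists (extend q p) => u v uv.
have [ux|vx|[u' [v' [ue ve]]]] := cases u v uv.
- by rewrite ux extend_at; apply: qd; rewrite -ux.
- by rewrite vx extend_at distrC dC; apply: qd; rewrite -vx adj_sym.
- rewrite ue ve !extend_val pd //= /contract_adj -ue -ve uv /= andbT.
  by apply: contraTneq uv => e; rewrite ue ve e adj_irr.
Qed.

Lemma no_K4_minor_flattenable (Y : normedModType R) (G : sgraph) :
  ~ has_minor G (complete 4) -> flattenable (l22 R) Y G.
Proof.
move=> noK4; apply/flattenableP => y.
apply: (no_K4_minor_realizable (d := fun u v => `|y u - y v|)) => //.
- by move=> u; rewrite subrr normr0.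
- by move=> u v; rewrite distrC.
- by move=> u v w; apply: ler_distD.
Qed.

End EuclideanPlane.

(** * Spaces whose quadruples are planar *)

Section FourPoint.
Local Open Scope ring_scope.
Variables (R : realType) (Y : normedModType R).

(** Any four points of [Y], one of them translated to the origin, embed
    isometrically in the Euclidean plane. *)
Definition four_point : Prop := forall x y z : Y, exists p q s : l22 R,
  [/\ `|p| = `|x|, `|q| = `|y| & `|s| = `|z|] /\
  [/\ `|p - q| = `|x - y|, `|p - s| = `|x - z| & `|q - s| = `|y - z|].

Lemma flattenable_K4_four_point :
  flattenable (l22 R) Y (complete 4) -> four_point.
Proof.
move=> /flattenableP fl x y z.
pose w (i : 'I_4) : Y := nth 0 [:: 0; x; y; z] i.
have [f fw] := fl w.
pose o k (k4 : (k < 4)%N) : 'I_4 := Ordinal k4.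
pose f0 := f (@o 0%N isT); pose f1 := f (@o 1%N isT).
pose f2 := f (@o 2%N isT); pose f3 := f (@o 3%N isT).
exists (f1 - f0), (f2 - f0), (f3 - f0).
have sub0 (V : zmodType) (a b c : V) : a - c - (b - c) = a - b.
  by rewrite opprB addrA subrK.
split; split; rewrite ?sub0 fw //= ?subr0 //.
Qed.

Hypothesis fp : four_point.
Implicit Types x y : Y.

(** The inner product of [x] and [y], expressed by the law of cosines so that it
    is visibly preserved by isometric embeddings of [0], [x], [y]. *)
Definition gram x y : R := (`|x| ^+ 2 + `|y| ^+ 2 - `|x - y| ^+ 2) / 2.

Lemma gramC x y : gram x y = gram y x.
Proof. by rewrite /gram distrC; congr (_ / _); ring. Qed.

(** In the plane the image of [t *: x] is determined by its distances to those of
    [0] and [x]: it is [t] times the image of [x].  The identity then holds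
    because it does in the plane. *)
Lemma normB_sqr x y t :
  `|y - t *: x| ^+ 2 = `|y| ^+ 2 - 2 * t * gram x y + t ^+ 2 * `|x| ^+ 2.
Proof.
have [p [q [s [[px qy sz] [pq ps qs]]]]] := fp x y (t *: x).
have sE : `|s| ^+ 2 = t ^+ 2 * `|p| ^+ 2.
  by rewrite sz normrZ exprMn real_normK ?num_real // px.
have psE : `|p - s| ^+ 2 = (1 - t) ^+ 2 * `|p| ^+ 2.
  rewrite ps -{1}(scale1r x) -scalerBl normrZ exprMn real_normK ?num_real //.
  by rewrite px.
have stp : s = t *: p.
  apply/eqP; rewrite -subr_eq0 -normr_eq0 -sqrf_eq0.
  move: sE psE; rewrite !l22_normK !coordE => sE psE.
  apply/eqP; transitivity ((1 - t) * (xc s ^+ 2 + yc s ^+ 2) +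
    t * ((xc p - xc s) ^+ 2 + (yc p - yc s) ^+ 2) +
    (t ^+ 2 - t) * (xc p ^+ 2 + yc p ^+ 2)); first by ring.
  by rewrite sE psE; ring.
rewrite -qs stp /gram -px -qy -pq !l22_normK !coordE; by field.
Qed.

(** [normB_sqr] with base [x] expands in [a]; used again with base [y], it expands
    the remaining [gram x (b *: y)] in [b]. *)
Lemma normD_sqr x y a b : `|a *: x + b *: y| ^+ 2 =
  a ^+ 2 * `|x| ^+ 2 + 2 * a * b * gram x y + b ^+ 2 * `|y| ^+ 2.
Proof.
have e : `|x - b *: y| ^+ 2 = _ := normB_sqr y x b.
rewrite addrC -[a *: x]opprK -scaleNr normB_sqr {1}/gram e (gramC y x).
by rewrite normrZ exprMn real_normK ?num_real //; field.
Qed.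

Lemma norm_midpoint_sqr x y z :
  `|z - 2^-1 *: (x + y)| ^+ 2 =
  (`|z - x| ^+ 2 + `|z - y| ^+ 2) / 2 - `|x - y| ^+ 2 / 4.
Proof.
have -> : z - 2^-1 *: (x + y) = (z - x) - 2^-1 *: (y - x).
  have -> : x + y = (2 : R) *: x + (y - x).
    by rewrite scaler_nat mulr2n addrACA subrr addr0.
  by rewrite scalerDr scalerA mulVf ?pnatr_eq0 // scale1r opprD addrA.
rewrite normB_sqr /gram.
have -> : y - x - (z - x) = y - z by rewrite opprB addrA subrK.
by rewrite (distrC y x) (distrC y z); field.
Qed.

Definition cross (p q : l22 R) : R := xc p * yc q - yc p * xc q.

(** Let [p, q, s] be the images of [x, y, z], and [s = a p + b q].  By [normB_sqr]
    the distances between [2a x], [2b y] and [z] are those between [2a p],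
    [2b q] and [s], so by the median formula [z] is at the same distance from
    the midpoint [a x + b y] as [s] is from [a p + b q].  This way no additivity
    of [gram] has to be established for three independent vectors. *)
Lemma four_point_dim3 : ~ dim_ge Y 3.
Proof.
move=> [v vi].
pose i0 : 'I_3 := @Ordinal 3 0 isT; pose i1 : 'I_3 := @Ordinal 3 1 isT.
pose i2 : 'I_3 := @Ordinal 3 2 isT.
have ind a b c : a *: v i0 + b *: v i1 + c *: v i2 = 0 ->
    [/\ a = 0, b = 0 & c = 0].
  move=> e; have h := vi (fun i => [:: a; b; c]`_i).
  have {}h : forall i : 'I_3, [:: a; b; c]`_i = 0.
    apply: h; rewrite !big_ord_recl big_ord0 addr0 -[RHS]e addrA.
    by do 2?congr (_ + _); congr (_ *: v _); apply: val_inj.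
  by split; [exact: (h i0) | exact: (h i1) | exact: (h i2)].
move: (v i0) (v i1) (v i2) ind => x y z ind.
have [p [q [s [[px qy sz] [pq ps qs]]]]] := fp x y z.
have transfer a b : `|a *: x + b *: y| ^+ 2 = `|a *: p + b *: q| ^+ 2.
  rewrite normD_sqr /gram -px -qy -pq !l22_normK !coordE; by field.
have dot_xz a : `|z - a *: x| ^+ 2 = `|s - a *: p| ^+ 2.
  rewrite normB_sqr /gram -px -sz -ps !l22_normK !coordE; by field.
have dot_yz a : `|z - a *: y| ^+ 2 = `|s - a *: q| ^+ 2.
  rewrite normB_sqr /gram -qy -sz -qs !l22_normK !coordE; by field.
have x0 : x != 0.
  apply/eqP => x0; have [|/eqP] := ind 1 0 0; last by rewrite oner_eq0.
  by rewrite x0 !scale0r scaler0 !addr0.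
(* If p and q were parallel, (p . q) x - |p|^2 y would have norm zero. *)
have pqN0 : cross p q != 0.
  apply/eqP => pq0.
  pose a := xc p * xc q + yc p * yc q.
  have /ind[_ /eqP + _] : a *: x + (- `|p| ^+ 2) *: y + 0 *: z = 0.
    apply/eqP; rewrite scale0r addr0 -normr_eq0 -sqrf_eq0 transfer.
    rewrite !l22_normK !coordE; apply/eqP.
    transitivity (cross p q ^+ 2 * (xc p ^+ 2 + yc p ^+ 2)).
      by rewrite /a /cross; ring.
    by rewrite pq0 expr0n mul0r.
  by rewrite oppr_eq0 sqrf_eq0 px normr_eq0 (negPf x0).
(* Cramer's rule for s = a p + b q. *)
pose a := cross s q / cross p q; pose b := cross p s / cross p q.
have xs : xc s = a * xc p + b * xc q.
  by rewrite /a /b; move: pqN0; rewrite /cross => pqN0; field.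
have ys : yc s = a * yc p + b * yc q.
  by rewrite /a /b; move: pqN0; rewrite /cross => pqN0; field.
have [|_ _ /eqP] := ind a b (-1); last by rewrite oppr_eq0 oner_eq0.
have -> : a *: x + b *: y = 2^-1 *: ((2 * a) *: x + (2 * b) *: y).
  by rewrite scalerDr !scalerA !mulrA mulVf ?mul1r // pnatr_eq0.
apply/eqP; rewrite -normr_eq0 -sqrf_eq0 scaleN1r distrC norm_midpoint_sqr.
rewrite dot_xz dot_yz -[- (_ *: y)]scaleNr transfer !l22_normK !coordE xs ys.
by apply/eqP; field.
Qed.

(** A basis of [Y] is made orthogonal for [gram] by one Gram-Schmidt step; by
    [normD_sqr] the coordinates along the normalized vectors are then an
    isometry. *)
Lemma four_point_dim2 : dim_eq Y 2 -> isometrically_isomorphic Y (l22 R).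
Proof.
move=> [v [vi vs]].
have ind a b : a *: v ord0 + b *: v ord_max = 0 -> a = 0 /\ b = 0.
  move=> e; have h := vi (fun i => if i == ord0 then a else b).
  have {}h : forall i : 'I_2, (if i == ord0 then a else b) = 0.
    apply: h; rewrite !big_ord_recl big_ord0 addr0 -[RHS]e /=.
    by congr (_ + _ *: v _); apply: val_inj.
  by split; [exact: (h ord0) | exact: (h ord_max)].
have span y : exists a b, y = a *: v ord0 + b *: v ord_max.
  have [c ->] := vs y; exists (c ord0), (c ord_max).
  rewrite !big_ord_recl big_ord0 addr0.
  by congr (_ + c _ *: v _); apply: val_inj.
move: (v ord0) (v ord_max) ind span => x y ind span.
have x0 : x != 0.
  apply/eqP => x0; have [|/eqP] := ind 1 0; last by rewrite oner_eq0.
  by rewrite x0 scale0r scaler0 addr0.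
have nx : 0 < `|x| by rewrite normr_gt0.
pose k := gram x y / `|x| ^+ 2; pose z := y - k *: x.
have z0 : z != 0.
  apply/eqP => z0; have [|_ /eqP] := ind (- k) 1; last by rewrite oner_eq0.
  by rewrite scaleNr scale1r addrC.
have nz : 0 < `|z| by rewrite normr_gt0.
have xz0 : gram x z = 0.
  rewrite /gram /z.
  have -> : x - (y - k *: x) = (1 + k) *: x + (- 1) *: y.
    by rewrite opprB scalerDl scale1r scaleN1r addrA.
  by rewrite normD_sqr normB_sqr /k; field; lra.
pose h (p : l22 R) : Y := (xc p / `|x|) *: x + (yc p / `|z|) *: z.
have hn p : `|h p| = `|p|.
  apply/eqP; rewrite -(eqrXn2 (n := 2)) // l22_normK normD_sqr xz0.
  by apply/eqP; field; lra.
have hl : linear h.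
  move=> t p q; rewrite /h !coordE [t *: _]scalerDr addrACA !scalerA -!scalerDl.
  by congr (_ *: _ + _ *: _); ring.
have hsurj w : exists p, h p = w.
  have [a [b ->]] := span w.
  exists (pt ((a + b * k) * `|x|) (b * `|z|)).
  rewrite /h !ptE !mulfK ?gt_eqF // /z scalerBr scalerA addrA addrAC.
  by rewrite -scalerBl addrK.
have [f fh] := choice hsurj.
pose hL : {linear l22 R -> Y} := HB.pack h (GRing.isLinear.Build _ _ _ _ h hl).
have hf : cancel h f.
  move=> p; apply/eqP; rewrite -subr_eq0 -normr_eq0 -hn.
  by rewrite (raddfB hL : forall p q, h (p - q) = h p - h q) fh subrr normr0.
have fl : linear f := can2_linear (f := hL) hf fh.
pose fL : {linear Y -> l22 R} := HB.pack f (GRing.isLinear.Build _ _ _ _ f fl).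
exists fL; split=> [|w]; first by exists h.
by rewrite -hn /= fh.
Qed.

End FourPoint.

(** * The two cases of the theorem *)

Section Embeddings.
Local Open Scope ring_scope.
Variables (R : realType) (Y : normedModType R).

Lemma flattenable_dim1 G : dim_eq Y 1 -> flattenable (l22 R) Y G.
Proof.
move=> [v [_ vs]]; apply/flattenableP => y.
have [u|c cE] := @choice _ _ (fun u c => y u = c *: v ord0).
  have [c ->] := vs (y u); exists (c ord0).
  by rewrite big_ord1.
exists (fun u => pt (c u * `|v ord0|) 0) => u w _.
apply: l22_norm_eq; rewrite ?normr_ge0 // !cE -scalerBl normrZ.
rewrite exprMn real_normK ?num_real // !coordE; ring.
Qed.

Lemma flattenable_isometric (X : normedModType R) G :
  isometrically_isomorphic Y X -> flattenable X Y G.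
Proof.
move=> [f [_ fn]]; apply/flattenableP => y; exists (f \o y) => u v _.
by rewrite /= -raddfB fn.
Qed.

End Embeddings.

Theorem theorem6p15 (R : realType) (Y : normedModType R) (Ypos : dim_ge Y 1) :
  (dim_eq Y 1 \/ (dim_eq Y 2 /\ isometrically_isomorphic Y (l22 R)) ->
    forall G : sgraph, has_edge G -> flattenable (l22 R) Y G) /\
  (dim_ge Y 3 \/ (dim_eq Y 2 /\ ~ isometrically_isomorphic Y (l22 R)) ->
    forall G : sgraph, has_edge G ->
      (flattenable (l22 R) Y G <-> ~ has_minor G (complete 4))).
Proof.
split=> [dimY G _|dimY G _].
  case: dimY => [Y1|[_ Yl2]]; first exact: flattenable_dim1.
  exact: flattenable_isometric.
split=> [flG K4|]; last exact: no_K4_minor_flattenable.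
have fp := flattenable_K4_four_point (flattenable_has_minor K4 flG).
case: dimY => [|[Y2 nY]]; first exact: four_point_dim3.
exact/nY/four_point_dim2.
Qed.
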